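(* Let $n\ge 4$ and let $\mathcal{G}=\{G_1,G_2,\ldots,G_n\}$ be a family of $n$ graphs, all on the same vertex set $[n]=\{1,\ldots,n\}$, such that $e(G_i)>\binom{n-1}{2}+1$ for every $i=1,2,\ldots,n$. Then $\mathcal{G}$ admits a rainbow Hamiltonian cycle.
   Context: $e(G)$ denotes the number of edges of $G$. Given a family $\mathcal{G}=\{G_1,\ldots,G_n\}$ of graphs on a common vertex set $V$ with $|V|=n$, a rainbow Hamiltonian cycle in $\mathcal{G}$ is a Hamiltonian cycle $C$ on $V$ (a cycle visiting every vertex exactly once, so it has $n$ edges) whose edges can be labeled $e_1,\ldots,e_n$ with $e_i\in E(G_i)$ for each $i$; i.e. distinct edges of $C$ belong to distinct graphs of the family, each graph used once. *)

(* Defs.v *)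
From mathcomp Require Import all_boot.
From mathcomp Require Import fingroup perm.
Set Implicit Arguments. Unset Strict Implicit. Unset Printing Implicit Defensive.

Definition simple_graph (n : nat) (G : {set {set 'I_n}}) : bool :=
  [forall e in G, #|e| == 2].

Definition nedges (n : nat) (G : {set {set 'I_n}}) : nat := #|G|.

(* The i-th edge of the Hamiltonian cycle given by the cyclic vertex order
   s : {perm 'I_n} (vertices s 0, s 1, ..., s (n-1), back to s 0). *)
Definition cyc_edge (n : nat) (s : {perm 'I_n}) (i : 'I_n) : {set 'I_n} :=
  [set s i; s (ordS i)].

Definition rainbow_ham_cycle (n : nat) (G : 'I_n -> {set {set 'I_n}}) : Prop :=
  exists (s : {perm 'I_n}) (p : {perm 'I_n}),
    forall i : 'I_n, cyc_edge s i \in G (p i).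

(* Main.v *)
(** Let [w x y] count the graphs that miss the pair [xy], so that the total
    weight of the pairs is at most [n (n - 3)], and let [C] be a Hamiltonian
    cycle of minimal weight [c] in the complete graph.  Exchanging two edges
    of [C] by reversing a segment gives, for all distinct positions [i] and [j],
    [w v_i v_(i+1) + w v_j v_(j+1) <= w v_i v_j + w v_(i+1) v_(j+1)].
    Summing over [j], each edge [e] of [C] satisfies
    [(n - 3) w e + c <= n (n - 3)]; summing over [i] and [j],
    [(n - 1) c <= 2 n (n - 3)].  If the edges of [C] could not be matched with
    the graphs containing them, Hall's theorem would give [a] edges of [C]
    missed by [b] common graphs with [a + b > n], hence [a <= n - 3],
    [w e >= b] on these edges and [c >= a b]: this contradicts the first
    inequality when [a <= 2] and the second one when [a >= 3]. *)

Require Import Defs.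
From mathcomp Require Import all_boot.
From mathcomp Require Import fingroup perm.
From mathcomp Require Import zify.
Set Implicit Arguments.
Unset Strict Implicit.
Unset Printing Implicit Defensive.

(** * Hall's marriage theorem *)

(* Induction on S: split off a tight nonempty proper subset if there is one,
   and otherwise a single index together with any of its values. *)
Lemma hall (I T : finType) (x0 : T) (S : {set I}) (F : I -> {set T}) :
  (forall A : {set I}, A \subset S -> #|A| <= #|\bigcup_(i in A) F i|) ->
  exists f : I -> T,
    {in S &, injective f} /\ {in S, forall i, f i \in F i}.
Proof.
have [m] := ubnP #|S|; elim: m S F => // m IHm S F ltSm hallF.
have [->|[i0 Si0]] := set_0Vmem S.
  by exists (fun=> x0); split=> [i j|i]; rewrite inE.
(* Gluing: representatives of [A] inside [N] are combined with representatives of [S :\: A] avoiding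
   [N], which the induction provides. *)
have split_hall (A : {set I}) (N : {set T}) : A \subset S -> A != set0 ->
    (exists g : I -> T,
      {in A &, injective g} /\ {in A, forall i, g i \in F i :&: N}) ->
    (forall B : {set I}, B \subset S :\: A ->
      #|B| <= #|(\bigcup_(i in B) F i) :\: N|) ->
    exists f : I -> T,
      {in S &, injective f} /\ {in S, forall i, f i \in F i}.
  move=> sAS A0 [g [inj_g gF]] hallN.
  have [||h [inj_h hF]] := IHm (S :\: A) (fun i => F i :\: N).
  - apply: leq_trans (proper_card _) (ltSm : #|S| <= m); rewrite properE subsetDl /=.
    have [i Ai] := set0Pn _ A0; apply/subsetPn.
    by exists i; [apply: (subsetP sAS) | rewrite inE Ai].
  - move=> B sB; apply: leq_trans (hallN B sB) _; apply: subset_leq_card.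
    apply/subsetP=> y; rewrite inE => /andP[yN /bigcupP[i Bi yi]].
    by apply/bigcupP; exists i; rewrite // inE yN.
  exists (fun i => if i \in A then g i else h i); split=> [i j|i] Si.
    move=> Sj; case: ifPn => Ai; case: ifPn => Aj.
    + exact: inj_g.
    + move=> e; have := hF j; rewrite !inE Aj Sj => /(_ isT).
      by have := gF i Ai; rewrite inE e => /andP[_ ->].
    + move=> e; have := hF i; rewrite !inE Ai Si => /(_ isT).
      by have := gF j Aj; rewrite inE e => /andP[_ ->].
    + by apply: inj_h; rewrite inE ?Ai ?Aj.
  case: ifPn => Ai; first by have /setIP[] := gF i Ai.
  by have := hF i; rewrite !inE Ai Si => /(_ isT) /andP[].
have [/existsP[A /and3P[A0 pAS /eqP tightA]]|noTight] := boolP [exists A : {set I},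
    [&& A != set0, A \proper S & #|\bigcup_(i in A) F i| == #|A|]].
  have sAS := proper_sub pAS.
  apply: (split_hall A (\bigcup_(i in A) F i)) => //.
    have [||g [inj_g gF]] := IHm A F.
    - exact: leq_trans (proper_card pAS) (ltSm : #|S| <= m).
    - by move=> B sBA; apply: hallF; apply: subset_trans sAS.
    exists g; split=> // i Ai; rewrite inE gF //=.
    by apply/bigcupP; exists i; rewrite ?gF.
  move=> B sB.
  have dAB : [disjoint A & B].
    by rewrite disjoint_sym; move: sB; rewrite subsetD => /andP[].
  have sBS : B \subset S by apply: subset_trans sB (subsetDl _ _).
  (* The tight set [A] uses exactly [#|A|] values, so at least [#|B|] of the values of [A :|: B] lie
     outside them. *)
  have := hallF (A :|: B); rewrite subUset sAS sBS => /(_ isT).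
  rewrite bigcup_setU !cardsU (disjoint_setI0 dAB) cards0 subn0 tightA.
  rewrite cardsD setIC; have := subset_leq_card (subsetIl
    (\bigcup_(i in B) F i) (\bigcup_(i in A) F i)).
  by lia.
have /card_gt0P[y Fy] : 0 < #|F i0|.
  have := hallF [set i0]; rewrite sub1set big_set1 cards1; exact.
apply: (split_hall [set i0] [set y]); rewrite ?sub1set ?set10 //.
- by apply/set0Pn; exists i0; rewrite inE.
- exists (fun=> y); split=> [i j /set1P-> /set1P->|i /set1P->] //.
  by rewrite !inE Fy eqxx.
move=> B sB; have [->|B0] := eqVneq B set0; first by rewrite cards0.
have pBS : B \proper S.
  by apply: sub_proper_trans sB (properD1 Si0).
(* As [B] is not tight, it has a value to spare, which pays for the removal of [y]. *)
have := hallF B (proper_sub pBS); rewrite leq_eqVlt eq_sym => /orP[tightB|].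
  by case/existsP: noTight; exists B; rewrite B0 pBS.
by rewrite cardsD; have := subset_leq_card (subsetIr (\bigcup_(i in B) F i) [set y]);
  rewrite cards1; lia.
Qed.

(** * Reversal of a segment of a cyclic order *)

(* Reversing the positions i+1, ..., j of a cyclic order exchanges its i-th and
   j-th edges for the chords s i -- s j and s (i+1) -- s (j+1). *)
Definition rev_seg (n : nat) (i j k : 'I_n) : 'I_n :=
  if i < k <= j then insubd k (i + j + 1 - k) else k.

(* The position in s of the edge found at position k after this reversal, when
   k is neither i nor j. *)
Definition rev_edge (n : nat) (i j k : 'I_n) : 'I_n :=
  if i < k < j then insubd k (i + j - k) else k.

Lemma val_rev_seg n (i j k : 'I_n) :
  rev_seg i j k = (if i < k <= j then i + j + 1 - k else k) :> nat.
Proof.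
rewrite /rev_seg; case: ifP => // ikj; rewrite val_insubd ifT //.
by have := ltn_ord j; lia.
Qed.

Lemma val_rev_edge n (i j k : 'I_n) :
  rev_edge i j k = (if i < k < j then i + j - k else k) :> nat.
Proof.
rewrite /rev_edge; case: ifP => // ikj; rewrite val_insubd ifT //.
by have := ltn_ord j; lia.
Qed.

Lemma rev_segK n (i j : 'I_n) : involutive (rev_seg i j).
Proof. by move=> k; apply: ord_inj; rewrite !val_rev_seg; do !case: ifP; lia. Qed.

Lemma rev_edgeK n (i j : 'I_n) : involutive (rev_edge i j).
Proof. by move=> k; apply: ord_inj; rewrite !val_rev_edge; do !case: ifP; lia. Qed.

Lemma val_ordS n (k : 'I_n) : ordS k = (if k.+1 == n then 0 else k.+1) :> nat.
Proof.
rewrite /=; case: eqP => [->|ne]; first exact: modnn.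
by rewrite modn_small //; have := ltn_ord k; lia.
Qed.

Definition cyc_weight (n : nat) (w : 'I_n -> 'I_n -> nat) (s : {perm 'I_n}) :=
  \sum_k w (s k) (s (ordS k)).

Section MinCycle.
Variables (n : nat) (w : 'I_n -> 'I_n -> nat).
Hypothesis wC : forall x y, w x y = w y x.
Hypothesis w0 : forall x, w x x = 0.

Lemma cyc_weight_rev (s : {perm 'I_n}) (i j : 'I_n) : i < j ->
  cyc_weight w (perm (inv_inj (rev_segK i j)) * s)%g
    + (w (s i) (s (ordS i)) + w (s j) (s (ordS j)))
  = cyc_weight w s + (w (s i) (s j) + w (s (ordS i)) (s (ordS j))).
Proof.
move=> ij; have nij : j != i by apply/eqP=> e; move: ij; rewrite e ltnn.
rewrite /cyc_weight (bigD1 i) //= (bigD1 j) //= [in RHS](bigD1 i) //=.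
rewrite [in RHS](bigD1 j) //= !permM !permE.
have -> : rev_seg i j i = i by apply: ord_inj; rewrite val_rev_seg; case: ifP; lia.
have -> : rev_seg i j j = ordS i.
  apply: ord_inj; rewrite val_rev_seg val_ordS; have := ltn_ord j.
  by do !case: ifP; lia.
have -> : rev_seg i j (ordS i) = j.
  apply: ord_inj; rewrite val_rev_seg val_ordS; have := ltn_ord j.
  by do !case: ifP; lia.
have -> : rev_seg i j (ordS j) = ordS j.
  apply: ord_inj; rewrite val_rev_seg val_ordS; have := ltn_ord j.
  by do !case: ifP; lia.
(* After reindexing, the summands agree one by one: edges inside the segment are traversed
   backwards, hence the use of [wC], and the others are unchanged. *)
rewrite [X in _ + (_ + X) + _ = _](reindex_inj (inv_inj (rev_edgeK i j))) /=.
set S1 := \sum_(_ | _) _; set S2 := \sum_(_ | _) _.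
suff -> : S1 = S2 by lia.
apply: eq_big => [k|k].
  by rewrite -!val_eqE /= !val_rev_edge; do !case: ifP; lia.
rewrite -!val_eqE /= !val_rev_edge => kij; rewrite !permM !permE.
have [/andP[ik kj]|out] := boolP (i < k < j).
  have -> : rev_seg i j (rev_edge i j k) = ordS k.
    apply: ord_inj; rewrite val_rev_seg val_rev_edge val_ordS.
    by have := ltn_ord j; do !case: ifP; lia.
  have -> : rev_seg i j (ordS (rev_edge i j k)) = k.
    apply: ord_inj; rewrite val_rev_seg val_ordS val_rev_edge.
    by have := ltn_ord j; do !case: ifP; lia.
  exact: wC.
have -> : rev_edge i j k = k by rewrite /rev_edge (negbTE out).
have -> : rev_seg i j k = k.
  apply: ord_inj; rewrite val_rev_seg.
  by move: kij out; do !case: ifP; lia.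
have -> // : rev_seg i j (ordS k) = ordS k.
apply: ord_inj; rewrite val_rev_seg val_ordS.
by move: kij out; have := ltn_ord j; do !case: ifP; lia.
Qed.

(** * Inequalities for a cycle of minimal weight *)

Variable s : {perm 'I_n}.
Hypothesis s_min : forall t, cyc_weight w s <= cyc_weight w t.

Lemma swap_le (i j : 'I_n) : i != j ->
  w (s i) (s (ordS i)) + w (s j) (s (ordS j))
    <= w (s i) (s j) + w (s (ordS i)) (s (ordS j)).
Proof.
have main (k l : 'I_n) : k < l ->
    w (s k) (s (ordS k)) + w (s l) (s (ordS l))
      <= w (s k) (s l) + w (s (ordS k)) (s (ordS l)).
  move=> kl; have := cyc_weight_rev s kl.
  by have := s_min (perm (inv_inj (rev_segK k l)) * s)%g; lia.
rewrite -val_eqE /= neq_ltn => /orP[/main//|/main].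
by rewrite (wC (s j) (s i)) (wC (s (ordS j))); lia.
Qed.

Definition wdeg (x : 'I_n) := \sum_y w x y.

(** Sum [swap_le] over all [j != i]. By [w0] the omitted terms on the right vanish, so full degrees
    appear there. *)
Lemma cyc_edge_wdeg (i : 'I_n) : 1 < n ->
  (n - 2) * w (s i) (s (ordS i)) + cyc_weight w s
    <= wdeg (s i) + wdeg (s (ordS i)).
Proof.
move=> n1; have H : \sum_(j | j != i) (w (s i) (s (ordS i)) + w (s j) (s (ordS j)))
  <= \sum_(j | j != i) (w (s i) (s j) + w (s (ordS i)) (s (ordS j))).
  by apply: leq_sum => j ij; apply: swap_le; rewrite eq_sym.
have E1 : wdeg (s i) = \sum_(j | j != i) w (s i) (s j).
  by rewrite /wdeg (reindex_inj (@perm_inj _ s)) (bigD1 i) //= w0.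
have E2 : wdeg (s (ordS i)) = \sum_(j | j != i) w (s (ordS i)) (s (ordS j)).
  rewrite /wdeg (reindex_inj (inj_comp (@perm_inj _ s) (@ordS_inj n))) /=.
  by rewrite (bigD1 i) //= w0.
rewrite E1 E2 -big_split /=; apply: leq_trans H.
rewrite big_split /= sum_nat_const cardC1 card_ord.
rewrite /cyc_weight [X in _ + X <= _](bigD1 i) //= addnA leq_add2r.
by rewrite -mulSnr leq_mul2r; lia.
Qed.

(** Each other vertex [z] has degree at least [w x z + w y z]. In [cyc_edge_total] the term
    [2 * w x y] turns the factor [n - 2] into [n - 3]. *)
Lemma wdeg_pair (x y : 'I_n) : x != y ->
  2 * (wdeg x + wdeg y) <= \sum_z wdeg z + 2 * w x y.
Proof.
move=> xy; rewrite (bigD1 x) //= (bigD1 y) 1?eq_sym //=.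
have H : \sum_(z | (z != x) && (z != y)) (w x z + w y z)
    <= \sum_(z | (z != x) && (z != y)) wdeg z.
  apply: leq_sum => z _; rewrite /wdeg (bigD1 x) //= (bigD1 y) 1?eq_sym //=.
  by rewrite (wC z x) (wC z y); lia.
have Dx : wdeg x = w x y + \sum_(z | (z != x) && (z != y)) w x z.
  by rewrite /wdeg (bigD1 x) //= (bigD1 y) 1?eq_sym //= w0.
have Dy : wdeg y = w x y + \sum_(z | (z != x) && (z != y)) w y z.
  by rewrite /wdeg (bigD1 x) //= (bigD1 y) 1?eq_sym //= w0 wC.
move: H; rewrite big_split /= {}Dx {}Dy.
by move: (\sum_(i | _) w x i) (\sum_(i | _) w y i) (\sum_(i | _) wdeg i); lia.
Qed.

Lemma cyc_weight_total : 1 < n -> (n - 1) * cyc_weight w s <= \sum_x wdeg x.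
Proof.
move=> n1; have H : \sum_i ((n - 2) * w (s i) (s (ordS i)) + cyc_weight w s)
    <= \sum_i (wdeg (s i) + wdeg (s (ordS i))).
  by apply: leq_sum => i _; apply: cyc_edge_wdeg.
move: H; rewrite !big_split /= -big_distrr /= sum_nat_const card_ord.
have -> : \sum_i wdeg (s i) = \sum_x wdeg x.
  by rewrite [RHS](reindex_inj (@perm_inj _ s)).
have -> : \sum_i wdeg (s (ordS i)) = \sum_x wdeg x.
  by rewrite [RHS](reindex_inj (inj_comp (@perm_inj _ s) (@ordS_inj n))).
rewrite -/(cyc_weight w s); move: (cyc_weight w s) (\sum_x _) => c W.
by case: n n1 => [|[|m]] // _; rewrite !subSS !subn0; nia.
Qed.

Lemma cyc_edge_total (i : 'I_n) : 2 < n ->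
  2 * ((n - 3) * w (s i) (s (ordS i)) + cyc_weight w s) <= \sum_x wdeg x.
Proof.
move=> n2; have n1 : 1 < n by lia.
have nei : s i != s (ordS i).
  rewrite (inj_eq (@perm_inj _ s)) -(inj_eq (@ord_inj n)) val_ordS.
  by have := ltn_ord i; case: ifP; lia.
have := cyc_edge_wdeg i n1; have := wdeg_pair nei.
move: (wdeg _) (wdeg _) (cyc_weight w s) (\sum_x _) (w _ _) => d1 d2 c W a.
case: n n2 => [|[|[|m]]] // _; rewrite !subSS ?subn0; nia.
Qed.

End MinCycle.

(** * Edge counts and derivation of the theorem *)

Lemma sum_ordered_edges (T : finType) (M : {set {set T}}) :
  (forall e, e \in M -> #|e| = 2) ->
  \sum_x \sum_y ([set x; y] \in M) <= 2 * #|M|.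
Proof.
move=> M2; rewrite pair_big /=.
rewrite (bigID (fun p : T * T => [set p.1; p.2] \in M)) /=.
rewrite [X in _ + X]big1 => [|p /negbTE->] //; rewrite addn0.
rewrite (partition_big (fun p : T * T => [set p.1; p.2]) (mem M)) //=.
rewrite mulnC -sum_nat_const; apply: leq_sum => e Me.
have /cards2P[a [b [ab De]]] : #|e| == 2 by rewrite M2.
apply: leq_trans (_ : #|[set (a, b); (b, a)]| <= 2); last by rewrite cards2; case: eqP.
rewrite -sum1_card big_mkcond [X in _ <= X]big_mkcond /=; apply: leq_sum => -[x y] _ /=.
case: ifP => // /andP[_ /eqP]; rewrite De => Exy.
suff -> : (x, y) \in [set (a, b); (b, a)] by case: (_ \in _).
have: x \in [set a; b] by rewrite -Exy set21.
have: y \in [set a; b] by rewrite -Exy set22.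
have: a \in [set x; y] by rewrite Exy set21.
have: b \in [set x; y] by rewrite Exy set22.
rewrite !inE !xpair_eqE.
by do 4![case/orP=> /eqP ?]; subst; rewrite ?eqxx ?orbT // in ab *.
Qed.

Lemma cyc_edge_card (n : nat) (s : {perm 'I_n}) (i : 'I_n) : 1 < n ->
  #|cyc_edge s i| = 2.
Proof.
move=> n1; rewrite /cyc_edge cards2 (inj_eq (@perm_inj _ s)).
rewrite -(inj_eq (@ord_inj n)) val_ordS.
by case: (_ =P _) => //; have := ltn_ord i; case: ifP; lia.
Qed.

Lemma cyc_edge_inj (n : nat) (s : {perm 'I_n}) : 2 < n -> injective (cyc_edge s).
Proof.
move=> n2 i j; rewrite /cyc_edge => E.
have: s i \in [set s j; s (ordS j)] by rewrite -E set21.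
have: s (ordS i) \in [set s j; s (ordS j)] by rewrite -E set22.
rewrite !inE !(inj_eq (@perm_inj _ s)) -!(inj_eq (@ord_inj n)) !val_ordS => H1 H2.
apply: ord_inj; move: H1 H2; have := ltn_ord i; have := ltn_ord j.
by do !case: ifP; lia.
Qed.

Lemma hall_violator_arith (n a b c : nat) :
  4 <= n -> 1 <= a -> a <= n - 3 -> n < a + b -> a * b <= c ->
  (n - 3) * b + c <= n * (n - 3) -> (n - 1) * c <= 2 * (n * (n - 3)) -> False.
Proof.
move=> n4 a1 an ab abc H1 H2.
case: a a1 an ab abc => [|[|[|x]]] // _ an ab abc.
- have := leq_mul (leqnn (n - 3)) (_ : n <= b); nia.
- have := leq_mul (leqnn (n - 3)) (_ : n - 1 <= b); nia.
(* Here [a = x + 3] and [y = n - 3 - a], so [a * b >= (x + 3) * (y + 4) >= 2 * n]. *)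
have [y Dn] : exists y, n = x + y + 6 by exists (n - 6 - x); lia.
have b4 : y + 4 <= b by lia.
have c2 : 2 * n <= c by apply: leq_trans abc; rewrite Dn; nia.
have := leq_mul (leqnn (n - 1)) c2; nia.
Qed.

Theorem mainTheorem1 (n : nat) (G : 'I_n -> {set {set 'I_n}}) :
  4 <= n ->
  (forall i, simple_graph (G i)) ->
  (forall i, 'C(n.-1, 2) + 1 < nedges (G i)) ->
  rainbow_ham_cycle G.
Proof.
move=> n4 simG eG.
pose M i := [set e : {set 'I_n} | #|e| == 2] :\: G i.
(* [C(n,2) - C(n-1,2) = n - 1], and [G i] has at least two edges more than [C(n-1,2)]. *)
have cardM i : #|M i| <= n - 3.
  have sG : G i \subset [set e : {set 'I_n} | #|e| == 2].
    by apply/subsetP=> e Ge; rewrite inE; have /forall_inP/(_ e Ge) := simG i.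
  rewrite cardsD (setIidPr sG) card_draws card_ord.
  have := eG i; rewrite /nedges; move: #|G i| => g.
  by case: (n) n4 => // m m3 /=; rewrite binS bin1; lia.
pose w x y := \sum_i ([set x; y] \in M i).
have wC x y : w x y = w y x by rewrite /w setUC.
have w0 x : w x x = 0.
  by rewrite /w big1 // => i _; rewrite !inE cards2 eqxx andbF.
have Wle : \sum_x wdeg w x <= 2 * (n * (n - 3)).
  rewrite /wdeg /w; under eq_bigr do rewrite exchange_big /=.
  rewrite exchange_big /=.
  apply: leq_trans (_ : \sum_(i < n) 2 * (n - 3) <= _); last first.
    by rewrite sum_nat_const card_ord; lia.
  apply: leq_sum => i _; apply: leq_trans (sum_ordered_edges _) _.
    by move=> e; rewrite !inE => /andP[_ /eqP].
  by rewrite leq_mul2l cardM.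
case: (@arg_minnP _ (1%g : {perm 'I_n}) xpredT (cyc_weight w) isT) => s _ s_min.
have {}s_min t : cyc_weight w s <= cyc_weight w t by apply: s_min.
have n1 : 1 < n by lia.
pose F k := [set i | cyc_edge s k \in G i].
have i0 : 'I_n by exists 0; lia.
have [A _|f [inj_f fF]] := @hall _ _ i0 [set: 'I_n] F; last first.
  have injf : injective f by move=> i j; apply: inj_f; rewrite inE.
  exists s, (perm injf) => i; rewrite permE.
  by have := fF i; rewrite !inE; apply.
rewrite leqNgt; apply/negP=> ltFA.
(* [B] consists of the graphs that contain none of the cycle edges in [A]. *)
pose B := ~: (\bigcup_(k in A) F k).
have missAB k i : k \in A -> i \in B -> cyc_edge s k \in M i.
  move=> Ak; rewrite !inE cyc_edge_card // eqxx andbT; apply: contra => Gki.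
  by apply/bigcupP; exists k; rewrite ?inE.
have cardAB : n < #|A| + #|B|.
  by have := cardsC (\bigcup_(k in A) F k); rewrite -/B card_ord; lia.
have leAn : #|A| <= n by rewrite -[n in _ <= n]card_ord max_card.
have /card_gt0P[i Bi] : 0 < #|B| by lia.
(* A single graph of [B] already misses all these edges, which are distinct. *)
have leA : #|A| <= n - 3.
  rewrite -(card_imset _ (@cyc_edge_inj n s _)); last by lia.
  apply: leq_trans (cardM i); apply: subset_leq_card.
  by apply/subsetP=> _ /imsetP[k Ak ->]; apply: missAB.
have leBw k : k \in A -> #|B| <= w (s k) (s (ordS k)).
  move=> Ak; rewrite -sum1_card big_mkcond; apply: leq_sum => j _.
  by case: ifP => // Bj; have := missAB k j Ak Bj; rewrite /cyc_edge => ->.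
have /card_gt0P[k Ak] : 0 < #|A| by lia.
apply: (@hall_violator_arith n #|A| #|B| (cyc_weight w s)) => //.
- by apply/card_gt0P; exists k.
- rewrite -sum_nat_const /cyc_weight [X in _ <= X](bigID (mem A)) /=.
  by apply: leq_trans (leq_addr _ _); apply: leq_sum.
- have := cyc_edge_total wC w0 s_min k (ltnW n4).
  have := leq_mul (leqnn (n - 3)) (leBw k Ak); move: Wle.
  by move: (_ * w _ _) (cyc_weight w s) (\sum_x _) => ? ? ?; lia.
exact: leq_trans (cyc_weight_total wC w0 s_min n1) Wle.
Qed.
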